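(* Let $T_n\in\mathbb{R}^{n\times n}$, $y_n,y_n^\delta\in\mathbb{R}^n$ with $\|y_n-y_n^\delta\|_2\le\delta$, let $x_n^\dagger=T_n^\dagger y_n$, let $i\ge 1$ be an integer, let $T_n^{(\ell)}$ be the Arnoldi approximation of $T_n$ obtained from $\ell$ steps of the Arnoldi process (without breakdown) with initial vector $y_n^\delta$, let $h_\ell\ge 0$ satisfy $\|T_n-T_n^{(\ell)}\|_2\le h_\ell$, and let $x_{\beta,n,i}^{\delta,\ell}$ denote the iterated Arnoldi-Tikhonov solution with parameter $\beta>0$, all as defined in the context. Set $C=1$ and $E=\|x_n^\dagger\|_2$, and assume that $$0\le E h_\ell+C\delta\le \|\mathcal{R}_\ell y_n^\delta\|_2 .$$ Assume that at least one of the first $\ell$ entries of $\hat y_{\ell+1}^\delta$ is nonzero and let $\alpha>0$ be the unique solution of $$\alpha^{2i+1}(\hat y_{\ell+1}^\delta)^{*}\bigl(\Sigma_{\ell+1,\ell}\Sigma_{\ell+1,\ell}^{*}+\alpha I_{\ell+1}\bigr)^{-2i-1}\hat y_{\ell+1}^\delta=(E h_\ell+C\delta)^2 .$$ Then for all $\tilde\alpha\ge\alpha$, $$\|x_n^\dagger-x_{\alpha,n,i}^{\delta,\ell}\|_2\le\|x_n^\dagger-x_{\tilde\alpha,n,i}^{\delta,\ell}\|_2 .$$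
   Context: $\|\cdot\|_2$ is the Euclidean vector norm and the induced (spectral) matrix norm; ${}^*$ is transposition; $I_k$ is the $k\times k$ identity; $T_n^\dagger$ is the Moore-Penrose pseudoinverse of $T_n$ (which need not be invertible). Arnoldi decomposition: let $1\le\ell<n$. Applying $\ell$ steps of the Arnoldi process to $T_n$ with initial vector $y_n^\delta$ gives $T_nV_{n,\ell}=V_{n,\ell+1}H_{\ell+1,\ell}$, where the columns of $V_{n,\ell+1}=[V_{n,\ell}\mid v^{(\ell+1)}_{n,\ell+1}]\in\mathbb{R}^{n\times(\ell+1)}$ form an orthonormal basis of the Krylov space $\mathcal{K}_{\ell+1}(T_n,y_n^\delta)=\mathrm{span}\{y_n^\delta,T_ny_n^\delta,\dots,T_n^{\ell}y_n^\delta\}$ and $H_{\ell+1,\ell}\in\mathbb{R}^{(\ell+1)\times\ell}$ is upper Hessenberg. It is assumed that the process does not break down, so $H_{\ell+1,\ell}$ has full rank $\ell$. The Arnoldi approximation is $T_n^{(\ell)}=V_{n,\ell+1}H_{\ell+1,\ell}V_{n,\ell}^{*}\in\mathbb{R}^{n\times n}$ (equivalently $T_n^{(\ell)}=T_nV_{n,\ell}V_{n,\ell}^*$). Iterated Arnoldi-Tikhonov (iAT) solution: for $\beta>0$ and integer $i\ge1$, $$x_{\beta,n,i}^{\delta,\ell}=\sum_{k=1}^{i}\beta^{k-1}(T_n^{(\ell)*}T_n^{(\ell)}+\beta I_n)^{-k}T_n^{(\ell)*}y_n^\delta .$$ Projector and SVD: $\mathcal{R}_\ell$ is the orthogonal projector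 of $\mathbb{R}^n$ onto the range of $T_n^{(\ell)}$. Let $H_{\ell+1,\ell}=U_{\ell+1}\Sigma_{\ell+1,\ell}S_\ell^{*}$ be a singular value decomposition, with $U_{\ell+1}\in\mathbb{R}^{(\ell+1)\times(\ell+1)}$, $S_\ell\in\mathbb{R}^{\ell\times\ell}$ orthogonal and $\Sigma_{\ell+1,\ell}\in\mathbb{R}^{(\ell+1)\times\ell}$ diagonal with nonincreasing singular values. Let $I_{\ell,\ell+1}=\begin{bmatrix}I_\ell&0\\0&0\end{bmatrix}\in\mathbb{R}^{(\ell+1)\times(\ell+1)}$, $y_{\ell+1}^\delta=V_{n,\ell+1}^{*}y_n^\delta$ and $\hat y_{\ell+1}^\delta=I_{\ell,\ell+1}U_{\ell+1}^{*}y_{\ell+1}^\delta$. *)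

(* Defs.v *)
From HB Require Import structures.
From mathcomp Require Import all_boot all_order all_algebra.
From mathcomp Require Import classical_sets reals.
Set Implicit Arguments.
Unset Strict Implicit.
Unset Printing Implicit Defensive.
Import Order.TTheory GRing.Theory Num.Theory.
Local Open Scope ring_scope.

Definition norm2 (R : realType) (n : nat) (x : 'cV[R]_n) : R :=
  Num.sqrt (\sum_i x i 0 ^+ 2).

Definition opnorm2 (R : realType) (m n : nat) (A : 'M[R]_(m, n)) : R :=
  sup [set norm2 (A *m x) | x in [set x : 'cV[R]_n | norm2 x <= 1]]%classic.

(* The four Penrose conditions, which determine X uniquely. *)
Definition moore_penrose (R : realType) (m n : nat)
    (A : 'M[R]_(m, n)) (X : 'M[R]_(n, m)) : Prop :=
  [/\ A *m X *m A = A, X *m A *m X = X,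
      (A *m X)^T = A *m X & (X *m A)^T = X *m A].

(* [%MS] compares row spaces, whence the transpose on A. *)
Definition orthogonal_projector_onto (R : realType) (m n : nat)
    (A : 'M[R]_(m, n)) (P : 'M[R]_m) : Prop :=
  [/\ P *m P = P, P^T = P & (P^T == A^T)%MS].

Definition krylov (R : realType) (n : nat) (T : 'M[R]_n) (y : 'cV[R]_n)
    (m : nat) : {vspace 'cV[R]_n} :=
  <<[seq iter k (mulmx T) y | k <- iota 0 m]>>%VS.

Definition hessenberg (R : realType) (m n : nat) (H : 'M[R]_(m, n)) : Prop :=
  forall (i : 'I_m) (j : 'I_n), (j.+1 < i)%N -> H i j = 0.

(* The Arnoldi decomposition T V_l = V_(l+1) H reached after l steps without
   breakdown from the initial vector y; V stands for V_(l+1), and V_l consists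
   of its first l columns. The signs of the columns of V after the first one
   are left free. *)
Record arnoldi (R : realType) (n l : nat) (T : 'M[R]_n) (y : 'cV[R]_n)
    (V : 'M[R]_(n, l + 1)) (H : 'M[R]_(l + 1, l)) : Prop := Arnoldi {
  arnoldi_start : forall j : 'I_(l + 1), j = 0%N :> nat -> col j V = (norm2 y)^-1 *: y;
  arnoldi_orthonormal : V^T *m V = 1%:M;
  arnoldi_basis : basis_of (krylov T y (l + 1)) [seq col j V | j : 'I_(l + 1)];
  arnoldi_relation : T *m lsubmx V = V *m H;
  arnoldi_hessenberg : hessenberg H;
  arnoldi_nobreakdown : \rank H = l
}.

Definition arnoldi_approx (R : realType) (n l : nat)
    (V : 'M[R]_(n, l + 1)) (H : 'M[R]_(l + 1, l)) : 'M[R]_n :=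
  V *m H *m (lsubmx V)^T.

Definition iterated_tikhonov (R : realType) (n : nat) (A : 'M[R]_n)
    (y : 'cV[R]_n) (i : nat) (beta : R) : 'cV[R]_n :=
  \sum_(1 <= k < i.+1)
    beta ^+ k.-1 *: (invmx (A^T *m A + beta%:M) ^+ k *m A^T *m y).

Record svd (R : realType) (m n : nat) (A : 'M[R]_(m, n))
    (U : 'M[R]_m) (S : 'M[R]_(m, n)) (W : 'M[R]_n) : Prop := Svd {
  svd_eq : A = U *m S *m W^T;
  svd_left : U^T *m U = 1%:M;
  svd_right : W^T *m W = 1%:M;
  svd_diag : forall (i : 'I_m) (j : 'I_n), i <> j :> nat -> S i j = 0;
  svd_ge0 : forall (i : 'I_m) (j : 'I_n), i = j :> nat -> 0 <= S i j;
  svd_sorted : forall (i i' : 'I_m) (j j' : 'I_n), i = j :> nat ->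
    i' = j' :> nat -> (i <= i')%N -> S i' j' <= S i j
}.

(* U and V are those of the SVD of H and of the Arnoldi decomposition. *)
Definition yhat (R : realType) (n l : nat) (V : 'M[R]_(n, l + 1))
    (U : 'M[R]_(l + 1)) (y : 'cV[R]_n) : 'cV[R]_(l + 1) :=
  block_mx 1%:M 0 0 0 *m U^T *m (V^T *m y).

(* Main.v *)
Require Import Defs.
From HB Require Import structures.
From mathcomp Require Import all_boot all_order all_algebra.
From mathcomp Require Import classical_sets reals.
From mathcomp Require Import ring lra.
Set Implicit Arguments.
Unset Strict Implicit.
Unset Printing Implicit Defensive.
Import Order.TTheory GRing.Theory Num.Theory.
Local Open Scope ring_scope.

(** The iterated Tikhonov solution is computed explicitly in a singular value
    decomposition of the Arnoldi approximation, and the inequality becomes a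
    scalar one.

    The SVD of H, multiplied by the orthonormal columns of V, yields a thin
    SVD [A = Q D P^T] of the Arnoldi approximation A, with [D = diag_mx s].
    Absence of breakdown makes every [s_j] positive ([svd_full_rank]).  Write
    [eta = Q^T ydelta], [c = P^T xdag], and [r_j(b) = b / (s_j^2 + b)].  The
    regularized solution with parameter b is P times the vector with entries
    [(1 - r_j(b)^i) eta_j / s_j] ([iterated_tikhonov_svd]).  Hence its squared
    distance to xdag is a term free of b plus
    [\sum_j ((e_j + r_j(b)^i eta_j) / s_j)^2], where [e_j = s_j c_j - eta_j]
    ([iterated_tikhonov_error]).

    Two facts on e and eta are used.  First, e is the projected residual
    [Q^T (A xdag - ydelta)], and its norm is at most [E h + delta]
    ([discrepancy_le]).  The component of y orthogonal to the range of T does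
    not contribute to e, because A is T times a projector, so that Q maps into
    the range of T ([penrose_residual_orthogonal]).  Second, the
    equation for alpha says exactly that
    [\sum_j r_j(alpha)^(2i+1) eta_j^2 = (E h + delta)^2]
    ([parameter_equation_diag]).

    It remains to compare the error sums at [a = alpha] and at [b >= a]
    ([filtered_error_le]).  Put [w_j = (r_j(b)^i - r_j(a)^i) / s_j^2] and
    [m_j = (r_j(b)^i + r_j(a)^i) / 2]; the difference of the sums is
    [\sum_j (2 w_j m_j eta_j^2 + 2 w_j eta_j e_j)].  The single constant
    [lambda = i (1/a - 1/b)] satisfies [w_j <= lambda m_j] and
    [lambda r_j(a)^(2i+1) <= w_j m_j] for every [s_j].  The first bound absorbs
    the cross terms,
    [w_j m_j eta_j^2 + 2 w_j eta_j e_j + lambda e_j^2 >= 0], and the second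
    bounds what remains below by
    [lambda (\sum_j r_j(a)^(2i+1) eta_j^2 - \sum_j e_j^2)], which is
    nonnegative by the two facts.  This is a finite-increment form of the sign
    computation for the derivative of the error, with lambda in the place of
    [i db / a^2]. *)

(** * Comparison of the filtered errors *)

Section Scalar.
Variable F : realFieldType.

(** For [y = x * exp (2 t)] this is [tanh (k t) <= k * tanh t]; the addition
    formulas for [y ^+ k.+1 - x ^+ k.+1] and [y ^+ k.+1 + x ^+ k.+1] in terms
    of [y ^+ k -+ x ^+ k] give the induction. *)
Lemma subrX_le_mean (x y : F) k : 0 <= x -> x <= y ->
  (y ^+ k - x ^+ k) * (y + x) <= k%:R * ((y - x) * (y ^+ k + x ^+ k)).
Proof.
move=> x0 xy; have y0 := le_trans x0 xy.
elim: k => [|k IH]; first by rewrite !expr0 subrr !mul0r.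
have xk : 0 <= x ^+ k by exact: exprn_ge0.
have xyk : x ^+ k <= y ^+ k by rewrite lerXn2r ?nnegrE.
rewrite -[k.+1]addn1 natrD !exprD !expr1.
set K := k%:R in IH *; have K0 : 0 <= K by rewrite ler0n.
set p := x ^+ k in IH xk xyk *; set q := y ^+ k in IH xyk *.
have -> : (q * y - p * x) * (y + x) =
  ((y + x) * ((q - p) * (y + x)) + (y - x) * (y + x) * (q + p)) / 2 by field.
have H1 : (y + x) * ((q - p) * (y + x)) <= (y + x) * (K * ((y - x) * (q + p))).
  by apply: ler_wpM2l => //; apply: addr_ge0.
have H2 : 0 <= K * (y - x) * ((y - x) * (q - p)).
  by rewrite !mulr_ge0 ?subr_ge0.
have H3 : 0 <= (y - x) * ((y - x) * (q - p)).
  by rewrite !mulr_ge0 ?subr_ge0.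
rewrite -subr_ge0.
have -> : (K + 1) * ((y - x) * (q * y + p * x)) -
   ((y + x) * ((q - p) * (y + x)) + (y - x) * (y + x) * (q + p)) / 2 =
 ((y + x) * (K * ((y - x) * (q + p))) - (y + x) * ((q - p) * (y + x)) +
  K * (y - x) * ((y - x) * (q - p)) + (y - x) * ((y - x) * (q - p))) / 2.
  by field.
apply: divr_ge0 => //.
by rewrite addr_ge0 // addr_ge0 // subr_ge0.
Qed.

(** Bernoulli's inequality in homogeneous form. *)
Lemma subrX_ge (x y : F) k : 0 <= x -> x <= y ->
  k.+1%:R * (x ^+ k * (y - x)) <= y ^+ k.+1 - x ^+ k.+1.
Proof.
move=> x0 xy; have y0 := le_trans x0 xy.
elim: k => [|k IH]; first by rewrite !expr1 expr0 !mul1r.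
have d0 : 0 <= y - x by rewrite subr_ge0.
have H1 := ler_wpM2r y0 IH.
have H2 : 0 <= k.+1%:R * (x ^+ k * (y - x)) * (y - x).
  by rewrite !mulr_ge0 ?exprn_ge0.
rewrite -[k.+2]addn1 natrD [y ^+ (_ + _)]exprD [x ^+ (_ + _)]exprD !expr1.
rewrite [x ^+ k.+1]exprS in H1 *.
set q := y ^+ k.+1 in H1 *; set p := x ^+ k in H1 H2 *.
set K := k.+1%:R in H1 H2 *.
rewrite -subr_ge0.
have -> : q * y - x * p * x - (K + 1) * (x * p * (y - x)) =
  (q - x * p) * y - K * (p * (y - x)) * y + K * (p * (y - x)) * (y - x).
  by ring.
by rewrite addr_ge0 // subr_ge0.
Qed.

(** The factor that one Tikhonov step with parameter a leaves of the data
    residual along a singular direction of singular value s. *)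
Definition damping (s a : F) : F := a / (s ^+ 2 + a).

Lemma damping_gt0 s a : 0 < s -> 0 < a -> 0 < damping s a.
Proof. by move=> s0 a0; rewrite divr_gt0 // addr_gt0 // exprn_gt0. Qed.

Lemma sub_damping s a b : 0 < s -> 0 < a -> 0 < b ->
  damping s b - damping s a = s ^+ 2 * (b - a) / ((s ^+ 2 + a) * (s ^+ 2 + b)).
Proof.
move=> s0 a0 b0; have s20 := exprn_gt0 2 s0; rewrite /damping; field.
by rewrite !gt_eqF //= addr_gt0.
Qed.

Lemma damping_le s a b : 0 < s -> 0 < a -> a <= b -> damping s a <= damping s b.
Proof.
move=> s0 a0 ab; have b0 := lt_le_trans a0 ab.
rewrite -subr_ge0 sub_damping // divr_ge0 ?mulr_ge0 ?subr_ge0 ?addr_ge0 //;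
  by rewrite ?sqr_ge0 // ltW.
Qed.

Section Increment.
Variables (s a b : F) (i : nat).
Hypotheses (s0 : 0 < s) (a0 : 0 < a) (ab : a <= b) (i0 : (0 < i)%N).
Let b0 : 0 < b := lt_le_trans a0 ab.
Let lam : F := i%:R * (a^-1 - b^-1).
Let ra := damping s a.
Let rb := damping s b.

(** [subrX_le_mean] reduces the bound to [i = 1], where it amounts to
    [2 * a * b <= s ^+ 2 * (a + b) + 2 * a * b]; equality as s tends to 0
    shows that lam is the least constant valid for all s. *)
Lemma damping_increment_le :
  (rb ^+ i - ra ^+ i) / s ^+ 2 <= lam * ((rb ^+ i + ra ^+ i) / 2).
Proof.
have s20 := exprn_gt0 2 s0.
have ra0 : 0 < ra := damping_gt0 s0 a0.
have rb0 : 0 < rb := damping_gt0 s0 b0.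
have rab : ra <= rb := damping_le s0 a0 ab.
have rs0 : 0 < rb + ra by rewrite addr_gt0.
rewrite ler_pdivrMr // -(ler_pM2r rs0).
apply: le_trans (subrX_le_mean i (ltW ra0) rab) _.
have -> : lam * ((rb ^+ i + ra ^+ i) / 2) * s ^+ 2 * (rb + ra) =
  i%:R * ((a^-1 - b^-1) * s ^+ 2 * (rb + ra) / 2 * (rb ^+ i + ra ^+ i)).
  by rewrite /lam; field; rewrite !gt_eqF.
apply: ler_wpM2l => //; apply: ler_wpM2r.
  by rewrite addr_ge0 // exprn_ge0 // ltW.
rewrite sub_damping // -subr_ge0.
have -> : (a^-1 - b^-1) * s ^+ 2 * (rb + ra) / 2 -
   s ^+ 2 * (b - a) / ((s ^+ 2 + a) * (s ^+ 2 + b)) =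
  (b - a) * (s ^+ 2 * (s ^+ 2 * (a + b))) /
    (2 * a * b * (s ^+ 2 + a) * (s ^+ 2 + b)).
  rewrite /ra /rb /damping; field.
  by rewrite !gt_eqF //= addr_gt0.
by rewrite divr_ge0 // !mulr_ge0 ?subr_ge0 // ?addr_ge0 //; apply/ltW.
Qed.

(** The right-hand side is [rb ^+ (2 * i) - ra ^+ (2 * i)] divided by
    [2 * s ^+ 2]; [subrX_ge] bounds it below by the tangent at ra, and then
    [a * (s ^+ 2 + b) <= b * (s ^+ 2 + a)] suffices. *)
Lemma damping_increment_ge :
  lam * ra ^+ (2 * i + 1) <=
    (rb ^+ i - ra ^+ i) / s ^+ 2 * ((rb ^+ i + ra ^+ i) / 2).
Proof.
have s20 := exprn_gt0 2 s0.
have ra0 : 0 < ra := damping_gt0 s0 a0.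
have rab : ra <= rb := damping_le s0 a0 ab.
have -> : (rb ^+ i - ra ^+ i) / s ^+ 2 * ((rb ^+ i + ra ^+ i) / 2) =
  (rb ^+ (2 * i) - ra ^+ (2 * i)) / (2 * s ^+ 2).
  by rewrite mulnC !exprM; field; rewrite !gt_eqF.
have := subrX_ge (2 * i).-1 (ltW ra0) rab.
rewrite prednK ?muln_gt0 // => H.
have d0 : 0 <= (2 * s ^+ 2)^-1 by rewrite invr_ge0 mulr_ge0 // ltW.
apply: le_trans (ler_wpM2r d0 H).
have -> : (2 * i + 1 = (2 * i).-1 + 2)%N.
  by rewrite -[in LHS](@prednK (2 * i)%N) ?muln_gt0 // addn1 addn2.
rewrite exprD natrM sub_damping // -subr_ge0.
set p := ra ^+ _.
have p0 : 0 <= p by rewrite exprn_ge0 // ltW.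
have -> : 2%:R * i%:R *
    (p * (s ^+ 2 * (b - a) / ((s ^+ 2 + a) * (s ^+ 2 + b)))) / (2 * s ^+ 2) - lam * (p * ra ^+ 2) =
  i%:R * p * (s ^+ 2 * (b - a) ^+ 2) / (b * (s ^+ 2 + a) ^+ 2 * (s ^+ 2 + b)).
  rewrite /lam /ra /damping; field.
  by rewrite !gt_eqF //= addr_gt0.
rewrite divr_ge0 // !mulr_ge0 ?subr_ge0 ?sqr_ge0 // ?addr_ge0 //; exact/ltW.
Qed.

End Increment.

(** The hypothesis is global in j while the two increment bounds are
    termwise: they combine because the constant lam is the same for all s,
    so that each term of the difference dominates lam times the corresponding
    term of the hypothesis. *)
Lemma filtered_error_le (I : finType) (s e y : I -> F) (a b : F) (i : nat) :
  (forall j, 0 < s j) -> 0 < a -> a <= b -> (0 < i)%N ->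
  \sum_j e j ^+ 2 <= \sum_j damping (s j) a ^+ (2 * i + 1) * y j ^+ 2 ->
  \sum_j ((e j + damping (s j) a ^+ i * y j) / s j) ^+ 2 <=
  \sum_j ((e j + damping (s j) b ^+ i * y j) / s j) ^+ 2.
Proof.
move=> s0 a0 ab i0; move: (ab).
rewrite le_eqVlt => /predU1P[<- //|ltab] He.
pose lam := i%:R * (a^-1 - b^-1).
have b0 := lt_trans a0 ltab.
have lam0 : 0 < lam by rewrite mulr_gt0 ?ltr0n // subr_gt0 ltf_pV2.
rewrite -subr_ge0 -sumrB.
have : 0 <= lam * \sum_j (damping (s j) a ^+ (2 * i + 1) * y j ^+ 2 - e j ^+ 2).
  by apply: mulr_ge0; [exact: ltW | rewrite sumrB subr_ge0].
move/le_trans; apply; rewrite mulr_sumr; apply: ler_sum => j _.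
have sj0 := s0 j.
have Hle := damping_increment_le i sj0 a0 ab.
have Hge := damping_increment_ge sj0 a0 ab i0.
have w0 : 0 <= (damping (s j) b ^+ i - damping (s j) a ^+ i) / s j ^+ 2.
  rewrite divr_ge0 ?sqr_ge0 // subr_ge0 lerXn2r ?nnegrE ?damping_le //.
    by apply/ltW/damping_gt0.
  by apply/ltW/damping_gt0.
have -> : ((e j + damping (s j) b ^+ i * y j) / s j) ^+ 2 -
   ((e j + damping (s j) a ^+ i * y j) / s j) ^+ 2 =
   2 * ((damping (s j) b ^+ i - damping (s j) a ^+ i) / s j ^+ 2) *
   ((damping (s j) b ^+ i + damping (s j) a ^+ i) / 2 * y j ^+ 2 + y j * e j).
  by field; rewrite gt_eqF.
rewrite -/lam in Hle Hge.
move: Hle Hge w0.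
set w := (_ - _) / _; set m := _ / 2; set g := damping _ _ ^+ (_ + _).
move=> Hle Hge w0.
have H1 : 0 <= lam * (w * m * y j ^+ 2 + 2 * w * y j * e j + lam * e j ^+ 2).
  (* Completing the square, after multiplication by lam. *)
  have -> : lam * (w * m * y j ^+ 2 + 2 * w * y j * e j + lam * e j ^+ 2) =
    w * (lam * m - w) * y j ^+ 2 + (w * y j + lam * e j) ^+ 2 by ring.
  have lw : 0 <= lam * m - w by rewrite subr_ge0.
  by rewrite addr_ge0 ?sqr_ge0 // mulr_ge0 ?sqr_ge0 // mulr_ge0.
rewrite pmulr_rge0 // in H1.
have H2 := ler_wpM2r (sqr_ge0 (y j)) Hge.
rewrite mulrBr -subr_ge0.
set X := (X in 0 <= X).
have -> : X = w * m * y j ^+ 2 + 2 * w * y j * e j + lam * e j ^+ 2 +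
   (w * m * y j ^+ 2 - lam * g * y j ^+ 2) by rewrite /X; ring.
by rewrite addr_ge0 // subr_ge0.
Qed.

End Scalar.

(** * The Euclidean norm and the spectral norm *)

Section Norm.
Variable R : realType.

Lemma sqr_norm2 n (x : 'cV[R]_n) : norm2 x ^+ 2 = \sum_i x i 0 ^+ 2.
Proof. by rewrite sqr_sqrtr // sumr_ge0 // => i _; exact: sqr_ge0. Qed.

Lemma norm2_ge0 n (x : 'cV[R]_n) : 0 <= norm2 x.
Proof. exact: sqrtr_ge0. Qed.

Lemma norm2_le_sqr n (x y : 'cV[R]_n) :
  norm2 x ^+ 2 <= norm2 y ^+ 2 -> norm2 x <= norm2 y.
Proof. by rewrite ler_pXn2r // nnegrE norm2_ge0. Qed.

Lemma dotE n (x y : 'cV[R]_n) : (x^T *m y) 0 0 = \sum_i x i 0 * y i 0.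
Proof. by rewrite mxE; apply: eq_bigr => i _; rewrite mxE. Qed.

Lemma sqr_norm2_dot n (x : 'cV[R]_n) : norm2 x ^+ 2 = (x^T *m x) 0 0.
Proof. by rewrite sqr_norm2 dotE; apply: eq_bigr => i _; rewrite expr2. Qed.

Lemma norm2_eq0 n (x : 'cV[R]_n) : norm2 x = 0 -> x = 0.
Proof.
move=> x0; have /eqP := sqr_norm2 x; rewrite x0 expr0n /= eq_sym.
rewrite psumr_eq0 => [/allP H|i _]; last exact: sqr_ge0.
apply/matrixP => i j; rewrite ord1 mxE.
by have := H i (mem_index_enum i); rewrite sqrf_eq0 => /eqP.
Qed.

Lemma norm2Z n (a : R) (x : 'cV[R]_n) : norm2 (a *: x) = `|a| * norm2 x.
Proof.
apply/eqP; rewrite -(eqrXn2 (n := 2)) ?mulr_ge0 ?norm2_ge0 //; apply/eqP.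
rewrite exprMn real_normK ?num_real // !sqr_norm2 mulr_sumr.
by apply: eq_bigr => i _; rewrite mxE exprMn.
Qed.

Lemma norm2N n (x : 'cV[R]_n) : norm2 (- x) = norm2 x.
Proof. by rewrite -scaleN1r norm2Z normrN1 mul1r. Qed.

Lemma sqr_norm2D n (x y : 'cV[R]_n) :
  norm2 (x + y) ^+ 2 = norm2 x ^+ 2 + 2 * (x^T *m y) 0 0 + norm2 y ^+ 2.
Proof.
rewrite !sqr_norm2 dotE mulr_sumr -!big_split /=.
by apply: eq_bigr => i _; rewrite mxE; ring.
Qed.

(** Cauchy-Schwarz, from the nonnegativity of the squared norm of
    [norm2 y ^+ 2 *: x - (x, y) *: y]. *)
Lemma dot_le_norm2 n (x y : 'cV[R]_n) : (x^T *m y) 0 0 <= norm2 x * norm2 y.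
Proof.
have [y0|/eqP yn0] := eqVneq (norm2 y) 0.
  by rewrite y0 (norm2_eq0 y0) mulmx0 mxE mulr0.
have yp : 0 < norm2 y by rewrite lt_neqAle norm2_ge0 eq_sym (introN eqP yn0).
set p := norm2 x; set q := norm2 y in yp *; set d := (X in X <= _).
have := sqr_ge0 (norm2 (q ^+ 2 *: x - d *: y)).
rewrite sqr_norm2D norm2N !norm2Z !exprMn !real_normK ?num_real //.
have -> : ((q ^+ 2 *: x)^T *m - (d *: y)) 0 0 = - (q ^+ 2 * d * d).
  by rewrite linearZ /= mulmxN -scalemxAl -scalemxAr scalerA mxE mxE.
rewrite -/p -/q => H.
have {}H : 0 <= q ^+ 2 * ((p * q) ^+ 2 - d ^+ 2) by apply: le_trans H _; lra.
rewrite pmulr_rge0 ?exprn_gt0 // subr_ge0 in H.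
have pq0 : 0 <= p * q by rewrite mulr_ge0 ?norm2_ge0.
have [d0|d0] := ltP 0 d; last exact: le_trans pq0.
by rewrite -(ler_pXn2r (n := 2)) // ?nnegrE // ltW.
Qed.

Lemma norm2_triangle n (x y : 'cV[R]_n) : norm2 (x + y) <= norm2 x + norm2 y.
Proof.
rewrite -(ler_pXn2r (n := 2)) ?nnegrE ?addr_ge0 ?norm2_ge0 //.
rewrite sqr_norm2D sqrrD lerD2r lerD2l mulr_natl lerMn2r /=.
exact: dot_le_norm2.
Qed.

Lemma norm2_isometry m n (P : 'M[R]_(m, n)) (x : 'cV[R]_n) :
  P^T *m P = 1%:M -> norm2 (P *m x) = norm2 x.
Proof.
move=> P1; apply/eqP; rewrite -(eqrXn2 (n := 2)) ?norm2_ge0 //.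
by rewrite !sqr_norm2_dot trmx_mul -mulmxA (mulmxA P^T) P1 mul1mx.
Qed.

Lemma sqr_norm2_isometryD m n (P : 'M[R]_(m, n)) (u : 'cV[R]_m) (x : 'cV[R]_n) :
  P^T *m P = 1%:M -> P^T *m u = 0 ->
  norm2 (u + P *m x) ^+ 2 = norm2 u ^+ 2 + norm2 x ^+ 2.
Proof.
move=> P1 Pu; rewrite sqr_norm2D norm2_isometry //.
rewrite mulmxA -[u^T *m P]trmxK trmx_mul trmxK Pu trmx0 mul0mx mxE.
by rewrite mulr0 addr0.
Qed.

Lemma norm2_coisometry_le m n (P : 'M[R]_(m, n)) (x : 'cV[R]_m) :
  P^T *m P = 1%:M -> norm2 (P^T *m x) <= norm2 x.
Proof.
move=> P1; rewrite -(ler_pXn2r (n := 2)) ?nnegrE ?norm2_ge0 //.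
rewrite -[X in _ <= norm2 X ^+ 2](subrK (P *m (P^T *m x))).
rewrite [X in _ <= X]sqr_norm2_isometryD //; first by rewrite lerDr sqr_ge0.
by rewrite mulmxBr (mulmxA P^T) P1 mul1mx subrr.
Qed.

(** Rescaling to the unit ball is the whole argument once the supremum that
    defines the spectral norm is known to be over a bounded set; a crude bound
    by the absolute row sums of A is enough for that. *)
Lemma norm2_mulmx_le_opnorm2 m n (A : 'M[R]_(m, n)) (x : 'cV[R]_n) :
  norm2 (A *m x) <= opnorm2 A * norm2 x.
Proof.
have [x0|xn0] := eqVneq (norm2 x) 0.
  rewrite x0 (norm2_eq0 x0) mulmx0 mulr0 -(scale0r (0 : 'cV[R]_m)).
  by rewrite norm2Z normr0 mul0r.
have xp : 0 < norm2 x by rewrite lt_neqAle norm2_ge0 eq_sym xn0.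
rewrite -ler_pdivrMr //.
have -> : norm2 (A *m x) / norm2 x = norm2 (A *m ((norm2 x)^-1 *: x)).
  by rewrite -scalemxAr norm2Z ger0_norm ?invr_ge0 ?norm2_ge0 // mulrC.
apply: ub_le_sup; last first.
  exists ((norm2 x)^-1 *: x) => //=.
  by rewrite norm2Z ger0_norm ?invr_ge0 ?norm2_ge0 // mulVf.
exists (Num.sqrt (\sum_i (\sum_j `|A i j|) ^+ 2)) => _ [z /= z1 <-].
rewrite ler_sqrt ?sumr_ge0 // => [|i _]; last exact: sqr_ge0.
apply: ler_sum => i _; rewrite mxE -real_normK ?num_real //.
rewrite lerXn2r ?nnegrE ?sumr_ge0 //.
apply: le_trans (ler_norm_sum _ _ _) _; apply: ler_sum => j _.
rewrite normrM ler_piMr //.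
rewrite -(ler_pXn2r (n := 2)) ?nnegrE // expr1n real_normK ?num_real //.
have : norm2 z ^+ 2 <= 1 by rewrite expr_le1 ?norm2_ge0.
apply: le_trans; rewrite sqr_norm2 (bigD1 j) //= lerDl.
by rewrite sumr_ge0 // => k _; exact: sqr_ge0.
Qed.

End Norm.

(** * Iterated Tikhonov regularization in a singular value decomposition *)

Section Diag.
Variable F : fieldType.

Lemma invmx_diagX m (d : 'rV[F]_m) k : (forall j, d 0 j != 0) ->
  invmx (diag_mx d) ^+ k = diag_mx (\row_j d 0 j ^- k).
Proof.
move=> d0.
have E : diag_mx d *m diag_mx (\row_j (d 0 j)^-1) = 1%:M.
  rewrite mulmx_diag -diag_const_mx; congr diag_mx.
  by apply/rowP => j; rewrite !mxE divff.
have [dU _] := mulmx1_unit E.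
have -> : invmx (diag_mx d) = diag_mx (\row_j (d 0 j)^-1).
  by rewrite -[RHS](mulKmx dU) E mulmx1.
elim: k => [|k IH].
  rewrite expr0 -[1]/(1%:M) -diag_const_mx; congr diag_mx.
  by apply/rowP => j; rewrite !mxE expr0 invr1.
rewrite exprS IH -mulmxE mulmx_diag; congr diag_mx.
by apply/rowP => j; rewrite !mxE exprS invfM.
Qed.

Lemma intertwine_invmxX n m (M : 'M[F]_n) (N : 'M[F]_m) (P : 'M[F]_(n, m)) k :
  M \in unitmx -> N \in unitmx -> M *m P = P *m N ->
  invmx M ^+ k *m P = P *m invmx N ^+ k.
Proof.
move=> MU NU MP.
have E : invmx M *m P = P *m invmx N.
  by rewrite -[LHS](mulmxK NU) -(mulmxA _ P) -MP mulKmx.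
elim: k => [|k IH]; first by rewrite !expr0 mul1mx mulmx1.
by rewrite !exprS -!mulmxE -mulmxA IH mulmxA E mulmxA.
Qed.

End Diag.

Section Tikhonov.
Variable R : realType.

(** A vector v in the kernel satisfies
    [norm2 (A *m v^T) ^+ 2 + b * norm2 v^T ^+ 2 = 0]. *)
Lemma shifted_gram_unit m n (A : 'M[R]_(m, n)) (b : R) : 0 < b ->
  A^T *m A + b%:M \in unitmx.
Proof.
move=> b0; rewrite -row_free_unit; apply: inj_row_free => v Hv.
have H : norm2 (A *m v^T) ^+ 2 + b * norm2 v^T ^+ 2 = 0.
  rewrite !sqr_norm2_dot trmx_mul !trmxK.
  have : (v *m (A^T *m A + b%:M) *m v^T) 0 0 = 0 by rewrite Hv mul0mx mxE.
  rewrite mulmxDr mulmxDl mul_mx_scalar -scalemxAl.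
  by rewrite mxE [X in _ + X]mxE !mulmxA.
have : norm2 v^T == 0.
  have bx0 : 0 <= b * norm2 v^T ^+ 2 := mulr_ge0 (ltW b0) (sqr_ge0 _).
  move/eqP: H; rewrite paddr_eq0 ?sqr_ge0 // => /andP[_].
  by rewrite mulrI_eq0 ?sqrf_eq0; [|apply/lregP; rewrite gt_eqF].
by move/eqP/norm2_eq0/(congr1 trmx); rewrite trmxK trmx0.
Qed.

(** A geometric sum: the ratio of its terms is [damping s b], and
    [1 - damping s b = s ^+ 2 / (s ^+ 2 + b)]. *)
Lemma sum_tikhonov_filter (s b : R) i : 0 < s -> 0 < b ->
  \sum_(1 <= k < i.+1) b ^+ k.-1 * ((s ^+ 2 + b) ^- k * s) =
  (1 - damping s b ^+ i) / s.
Proof.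
move=> s0 b0; have v0 : s ^+ 2 + b != 0.
  by rewrite gt_eqF // addr_gt0 // exprn_gt0.
elim: i => [|i IH]; first by rewrite big_geq // expr0 subrr mul0r.
rewrite big_nat_recr //= IH /damping !exprSr expr_div_n.
field.
by rewrite expr0 mul1r -expr2 v0 expf_neq0 // gt_eqF.
Qed.

(** The columns of P are eigenvectors of [A^T *m A + b%:M], and [A^T *m y] is a
    combination of them. *)
Lemma iterated_tikhonov_svd n l (A : 'M[R]_n) (Q P : 'M[R]_(n, l))
    (s : 'rV[R]_l) (y : 'cV[R]_n) i (b : R) :
  A = Q *m diag_mx s *m P^T -> Q^T *m Q = 1%:M -> P^T *m P = 1%:M ->
  (forall j, 0 < s 0 j) -> 0 < b ->
  iterated_tikhonov A y i b =
  P *m \col_j ((1 - damping (s 0 j) b ^+ i) / s 0 j * (Q^T *m y) j 0).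
Proof.
move=> AE Q1 P1 s0 b0.
pose d : 'rV[R]_l := \row_j (s 0 j ^+ 2 + b).
have d0 j : d 0 j != 0 by rewrite mxE gt_eqF // addr_gt0 // exprn_gt0.
have AT : A^T = P *m diag_mx s *m Q^T.
  by rewrite AE !trmx_mul trmxK tr_diag_mx mulmxA.
have dU : diag_mx d \in unitmx.
  by rewrite unitmxE det_diag unitfE; apply/prodf_neq0.
have MP : (A^T *m A + b%:M) *m P = P *m diag_mx d.
  rewrite mulmxDl {2}AE AT -!mulmxA P1 mulmx1 (mulmxA Q^T) Q1 mul1mx mulmx_diag.
  rewrite mul_scalar_mx -mul_mx_scalar -mulmxDr; congr (_ *m _).
  rewrite -diag_const_mx -raddfD; congr diag_mx.
  by apply/rowP => j; rewrite !mxE expr2.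
rewrite /iterated_tikhonov.
under eq_bigr => k _.
  rewrite {2}AT !mulmxA (intertwine_invmxX k (shifted_gram_unit A b0) dU MP).
  rewrite invmx_diagX // -!mulmxA scalemxAr.
  over.
rewrite -mulmx_sumr; congr (_ *m _); apply/colP => j.
rewrite summxE [RHS]mxE -sum_tikhonov_filter // mulr_suml.
apply: eq_bigr => k _.
by rewrite mxE mul_diag_mx mxE mul_diag_mx !mxE !mulrA.
Qed.

End Tikhonov.

(** * The Arnoldi approximation *)

Section ArnoldiTikhonov.
Variable R : realType.

(** A vanishing singular value would put a column of S in the kernel of H. *)
Lemma svd_full_rank l (H Sigma : 'M[R]_(l + 1, l)) U S :
  svd H U Sigma S -> \rank H = l ->
  exists2 s : 'rV[R]_l, Sigma = col_mx (diag_mx s) 0 & forall j, 0 < s 0 j.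
Proof.
move=> [HE U1 S1 diag ge0 _] rkH.
have SE : Sigma = col_mx (diag_mx (\row_j Sigma (lshift 1 j) j)) 0.
  rewrite -[LHS]vsubmxK; congr col_mx; apply/matrixP => i j; rewrite !mxE.
    have [->|ij] := eqVneq i j; first by rewrite mulr1n.
    by rewrite mulr0n diag //; apply/eqP.
  by rewrite diag //= => lij; have := ltn_ord j; rewrite -lij ltnNge leq_addr.
exists (\row_j Sigma (lshift 1 j) j) => // j.
rewrite mxE lt_neqAle ge0 // andbT eq_sym; apply/eqP => sj0.
have Hfree : row_free H^T by rewrite /row_free mxrank_tr rkH.
have HS0 : H *m (S *m delta_mx j (0 : 'I_1)) = 0.
  rewrite HE -!mulmxA (mulmxA S^T) S1 mul1mx SE mul_col_mx mul0mx.
  rewrite mul_diag_mx; set M := \matrix_(_, _) _.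
  suff -> : M = 0 by rewrite col_mx0 mulmx0.
  apply/matrixP => i k; rewrite !mxE.
  by have [->|ij] := eqVneq i j; rewrite ?sj0 ?mul0r // mulr0.
have : (S *m delta_mx j (0 : 'I_1))^T = 0.
  by apply: (row_free_inj Hfree); rewrite mul0mx -trmx_mul HS0 trmx0.
move/(congr1 trmx); rewrite trmxK trmx0 => /(congr1 (mulmx S^T)).
rewrite mulmxA S1 mul1mx mulmx0 => /matrixP/(_ j 0).
by rewrite !mxE !eqxx => /eqP; rewrite oner_eq0.
Qed.

(** [T *m Tdag] is the orthogonal projector onto the range of T, which contains
    the columns of Q because Q spans the range of [T *m B]. *)
Lemma penrose_residual_orthogonal n l (T Tdag B : 'M[R]_n) (Q P : 'M[R]_(n, l))
    (s : 'rV[R]_l) :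
  moore_penrose T Tdag -> T *m B = Q *m diag_mx s *m P^T ->
  P^T *m P = 1%:M -> (forall j, 0 < s 0 j) ->
  Q^T *m (T *m Tdag) = Q^T.
Proof.
move=> [TXT _ TXsym _] AE P1 s0.
have sU : diag_mx s \in unitmx.
  by rewrite unitmxE det_diag unitfE; apply/prodf_neq0 => j _; rewrite gt_eqF.
have QE : Q = T *m B *m P *m invmx (diag_mx s).
  by rewrite AE -(mulmxA _ P^T) P1 mulmx1 mulmxK.
rewrite -[in LHS]TXsym -trmx_mul; congr trmx.
by rewrite {1}QE !mulmxA TXT -QE.
Qed.

(** With [x = Tdag *m y], the vector on the left is [Q^T (A x - yd)], and
    [A x - yd = - (T - A) x + (T x - y) + (y - yd)], whose middle term Q^T
    annihilates. *)
Lemma discrepancy_le n l (T Tdag A B : 'M[R]_n) (Q P : 'M[R]_(n, l))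
    (s : 'rV[R]_l) (y yd : 'cV[R]_n) (delta h : R) :
  moore_penrose T Tdag -> norm2 (y - yd) <= delta -> opnorm2 (T - A) <= h ->
  A = T *m B -> A = Q *m diag_mx s *m P^T ->
  Q^T *m Q = 1%:M -> P^T *m P = 1%:M -> (forall j, 0 < s 0 j) ->
  norm2 (diag_mx s *m (P^T *m (Tdag *m y)) - Q^T *m yd) <=
  norm2 (Tdag *m y) * h + delta.
Proof.
move=> MP yyd TAh AB AE Q1 P1 s0; set x := Tdag *m y.
have QT : Q^T *m (T *m x) = Q^T *m y.
  rewrite /x mulmxA mulmxA -(mulmxA Q^T).
  by rewrite (penrose_residual_orthogonal MP (etrans (esym AB) AE) P1 s0).
have -> : diag_mx s *m (P^T *m x) - Q^T *m yd =
    Q^T *m (- ((T - A) *m x) + (y - yd)).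
  rewrite mulmxDr mulmxN mulmxBl mulmxBr QT AE -!mulmxA.
  rewrite (mulmxA Q^T Q) Q1 mul1mx.
  by rewrite mulmxBr opprB addrA subrK.
apply: le_trans (norm2_coisometry_le _ Q1) _.
apply: le_trans (norm2_triangle _ _) _; apply: lerD => //.
rewrite norm2N mulrC; apply: le_trans (norm2_mulmx_le_opnorm2 _ _) _.
by rewrite ler_wpM2r ?norm2_ge0.
Qed.

(** Pythagoras along the range of P, to which all regularized solutions
    belong. *)
Lemma iterated_tikhonov_error n l (A : 'M[R]_n) (Q P : 'M[R]_(n, l))
    (s : 'rV[R]_l) (x yd : 'cV[R]_n) i (b : R) :
  A = Q *m diag_mx s *m P^T -> Q^T *m Q = 1%:M -> P^T *m P = 1%:M ->
  (forall j, 0 < s 0 j) -> 0 < b ->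
  let e := diag_mx s *m (P^T *m x) - Q^T *m yd in
  norm2 (x - iterated_tikhonov A yd i b) ^+ 2 =
  norm2 (x - P *m (P^T *m x)) ^+ 2 +
  \sum_j ((e j 0 + damping (s 0 j) b ^+ i * (Q^T *m yd) j 0) / s 0 j) ^+ 2.
Proof.
move=> AE Q1 P1 s0 b0 e.
rewrite (iterated_tikhonov_svd _ _ AE) //; set g := \col_j _.
have -> : x - P *m g = x - P *m (P^T *m x) + P *m (P^T *m x - g).
  by rewrite mulmxBr addrA subrK.
rewrite sqr_norm2_isometryD //; last first.
  by rewrite mulmxBr (mulmxA P^T P) P1 mul1mx subrr.
congr (_ + _); rewrite sqr_norm2; apply: eq_bigr => j _; congr (_ ^+ 2).
rewrite /e /g; move: (P^T *m x) (Q^T *m yd) => c eta.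
by rewrite mul_diag_mx !mxE; field; rewrite gt_eqF.
Qed.

Lemma diag_quadratic_form m (d : 'rV[R]_m) (v : 'cV[R]_m) :
  (v^T *m diag_mx d *m v) 0 0 = \sum_j d 0 j * v j 0 ^+ 2.
Proof.
by rewrite mul_mx_diag mxE; apply: eq_bigr => j _; rewrite !mxE; ring.
Qed.

(** The left-hand side is that of the equation defining alpha.  The last
    diagonal entry of [Sigma *m Sigma^T + a%:M], which is a, meets the zero
    entry of v. *)
Lemma parameter_equation_diag l (s : 'rV[R]_l) (z : 'cV[R]_l) (a : R) k :
  (forall j, 0 < s 0 j) -> 0 < a ->
  let Sigma := col_mx (diag_mx s) 0 : 'M[R]_(l + 1, l) in
  let v := col_mx z 0 : 'cV[R]_(l + 1) in
  a ^+ k * (v^T *m invmx (Sigma *m Sigma^T + a%:M) ^+ k *m v) 0 0 =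
  \sum_j damping (s 0 j) a ^+ k * z j 0 ^+ 2.
Proof.
move=> s0 a0 Sigma v.
pose d : 'rV[R]_(l + 1) := row_mx (\row_j (s 0 j ^+ 2 + a)) (const_mx a).
have -> : Sigma *m Sigma^T + a%:M = diag_mx d.
  rewrite /Sigma tr_col_mx tr_diag_mx trmx0 mul_col_row !mulmx0 !mul0mx.
  rewrite scalar_mx_block add_block_mx !addr0 add0r mulmx_diag.
  rewrite diag_mx_row diag_const_mx -[a%:M in LHS]diag_const_mx -raddfD /=.
  congr (block_mx (diag_mx _) _ _ _).
  by apply/rowP => j; rewrite !mxE expr2.
have d0 j : d 0 j != 0.
  rewrite gt_eqF // /d mxE; case: split => j' /=; rewrite !mxE //.
  by rewrite addr_gt0 // exprn_gt0.
rewrite invmx_diagX // diag_quadratic_form big_split_ord /= big_ord1.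
have -> : v (rshift l 0) 0 = 0 by rewrite /v col_mxEd mxE.
rewrite expr0n mulr0 addr0 mulr_sumr.
have vu j : v (lshift 1 j) 0 = z j 0 by rewrite /v col_mxEu.
have du j : d 0 (lshift 1 j) = s 0 j ^+ 2 + a by rewrite /d row_mxEl mxE.
clearbody v d; apply: eq_bigr => j _; rewrite vu mxE du.
by rewrite expr_div_n mulrA.
Qed.

Lemma lsubmx_isometry n l (W : 'M[R]_(n, l + 1)) :
  W^T *m W = 1%:M -> (lsubmx W)^T *m lsubmx W = 1%:M.
Proof.
rewrite -{1 2}[W]hsubmxK tr_row_mx mul_col_row scalar_mx_block.
by move/eq_block_mx => [].
Qed.

Lemma yhat_col_mx n l (V : 'M[R]_(n, l + 1)) U (y : 'cV[R]_n) :
  yhat V U y = col_mx ((lsubmx (V *m U))^T *m y) 0.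
Proof.
rewrite /yhat trmx_lsub mul_usub_mx -mulmxA (mulmxA U^T) -trmx_mul.
rewrite -{1}[_ *m y]vsubmxK mul_block_col.
by rewrite mul1mx !mul0mx !addr0.
Qed.

End ArnoldiTikhonov.

Theorem proposition1 (R : realType) (n l i : nat)
    (T Tdag : 'M[R]_n) (y ydelta xdag : 'cV[R]_n)
    (V : 'M[R]_(n, l + 1)) (H : 'M[R]_(l + 1, l)) (Rl : 'M[R]_n)
    (U : 'M[R]_(l + 1)) (Sigma : 'M[R]_(l + 1, l)) (S : 'M[R]_l)
    (delta h C E alpha : R) :
  (1 <= l)%N -> (l < n)%N -> (1 <= i)%N ->
  norm2 (y - ydelta) <= delta ->
  moore_penrose T Tdag ->
  xdag = Tdag *m y ->
  arnoldi T ydelta V H ->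
  0 <= h ->
  opnorm2 (T - arnoldi_approx V H) <= h ->
  orthogonal_projector_onto (arnoldi_approx V H) Rl ->
  svd H U Sigma S ->
  C = 1 ->
  E = norm2 xdag ->
  0 <= E * h + C * delta <= norm2 (Rl *m ydelta) ->
  (exists j : 'I_l, yhat V U ydelta (lshift 1 j) 0 != 0) ->
  0 < alpha ->
  alpha ^+ (2 * i + 1) *
    ((yhat V U ydelta)^T *m
     invmx (Sigma *m Sigma^T + alpha%:M) ^+ (2 * i + 1) *m
     yhat V U ydelta) 0 0 = (E * h + C * delta) ^+ 2 ->
  forall alpha' : R, alpha <= alpha' ->
    norm2 (xdag - iterated_tikhonov (arnoldi_approx V H) ydelta i alpha)
    <= norm2 (xdag - iterated_tikhonov (arnoldi_approx V H) ydelta i alpha').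
Proof.
move=> _ _ i0 yyd MP xE arn _ TAh _ svdH -> EE /andP[Eh0 _] _ a0 aE a' aa'.
rewrite {}EE {}xE mul1r in aE Eh0 *.
case: arn => _ V1 _ TV _ rkH.
have [s SE s0] := svd_full_rank svdH rkH; case: svdH => HE U1 S1 _ _ _.
set A := arnoldi_approx V H in TAh *.
pose Q := lsubmx (V *m U); pose P := lsubmx V *m S.
have Q1 : Q^T *m Q = 1%:M.
  by apply: lsubmx_isometry; rewrite trmx_mul -mulmxA (mulmxA V^T) V1 mul1mx.
have P1 : P^T *m P = 1%:M.
  by rewrite trmx_mul -mulmxA (mulmxA _ (lsubmx V)) lsubmx_isometry // mul1mx.
have AE : A = Q *m diag_mx s *m P^T.
  rewrite /A /arnoldi_approx HE SE !mulmxA trmx_mul mulmxA -[V *m U]hsubmxK.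
  by rewrite mul_row_col mulmx0 addr0.
have AB : A = T *m (lsubmx V *m (lsubmx V)^T) by rewrite mulmxA TV.
have yhatE : yhat V U ydelta = col_mx (Q^T *m ydelta) 0 := yhat_col_mx V U _.
clearbody A P Q; rewrite yhatE SE parameter_equation_diag // in aE.
have eh := discrepancy_le MP yyd TAh AB AE Q1 P1 s0.
apply: norm2_le_sqr.
have Er := iterated_tikhonov_error (Tdag *m y) ydelta i AE Q1 P1 s0.
rewrite [X in X <= _](Er _ a0) [X in _ <= X](Er _ (lt_le_trans a0 aa')).
rewrite lerD2l; apply: filtered_error_le => //.
rewrite aE -sqr_norm2; apply: lerXn2r eh; rewrite nnegrE //.
exact: norm2_ge0.
Qed.
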